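(* Let $(X,d)$ be a compact metric space, let $\mathcal{F}=\{f_1,\dots,f_k\}$ be a finite family of continuous maps $f_i:X\to X$ with $X=\bigcup_{i=1}^k f_i(X)$, and let $F$ be the relation $F(x)=\{f_1(x),\dots,f_k(x)\}$. If $\mathrm{IFS}(X;\mathcal{F})$ is weak topologically exact but not minimal, then $(X,F)$ is not equicontinuous.
   Context: $\mathcal{F}^+$ is the semigroup of all compositions of finitely many (at least one) elements of $\mathcal{F}$, and $\mathrm{IFS}(X;\mathcal{F})$ is the associated iterated function system. It is weak topologically exact if for every nonempty open set $U\subseteq X$ there are finitely many $T_1,\dots,T_N\in\mathcal{F}^+$ such that $\bigcup_{i=1}^N T_i(U)$ is dense in $X$. It is minimal if for every $x\in X$ the forward orbit $\{h(x):h\in\mathcal{F}^+\}$ is dense in $X$. For $\omega=(\omega_1\omega_2\dots)\in\{1,\dots,k\}^{\mathbb{N}}$ put $f_\omega^0=\mathrm{Id}$ and $f_\omega^n=f_{\omega_n}\circ f_\omega^{n-1}$ for $n\ge1$. Define $d_{\mathcal{F}}(x_1,x_2)=\sup_{\omega,\,n\ge0}d(f_\omega^n(x_1),f_\omega^n(x_2))$. $(X,F)$ is equicontinuous if the identity map $(X,d)\to(X,d_{\mathcal{F}})$ is continuous at every point of $X$. *)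

(* Defs.v *)
From mathcomp Require Import all_boot all_order all_algebra.
From mathcomp Require Import all_classical all_reals all_analysis.

Set Implicit Arguments.
Unset Strict Implicit.
Unset Printing Implicit Defensive.

Import Order.TTheory GRing.Theory Num.Theory.

Local Open Scope classical_set_scope.
Local Open Scope ring_scope.

(* A family {f_1, ..., f_k} is given as f : 'I_k -> X -> X, with indices
   0, ..., k - 1. *)

Definition ifs_semigroup (X : Type) (k : nat) (f : 'I_k -> X -> X) :
    set (X -> X) :=
  [set h | exists2 s : seq 'I_k,
    s != [::] & h = foldr (fun i g => f i \o g) idfun s].

Definition weak_topologically_exact (X : topologicalType) (k : nat)
    (f : 'I_k -> X -> X) : Prop :=
  forall U : set X, open U -> U !=set0 ->
    exists (N : nat) (T : 'I_N -> X -> X),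
      (forall i, ifs_semigroup f (T i)) /\
      dense (\bigcup_(i in [set: 'I_N]) (T i @` U)).

Definition ifs_minimal (X : topologicalType) (k : nat)
    (f : 'I_k -> X -> X) : Prop :=
  forall x : X, dense [set h x | h in ifs_semigroup f].

(* The sequence omega_1 omega_2 ... is indexed from 0 here, so w n stands for
   omega_(n+1). *)
Fixpoint ifs_iter (X : Type) (k : nat) (f : 'I_k -> X -> X) (w : nat -> 'I_k)
    (n : nat) : X -> X :=
  if n is m.+1 then f (w m) \o ifs_iter f w m else idfun.

(* The supremum is taken in the extended reals, so that it is meaningful
   without a boundedness proof; it is finite when X is compact and k > 0. *)
Definition ifs_dist (R : realType) (X : metricType R) (k : nat)
    (f : 'I_k -> X -> X) (x1 x2 : X) : \bar R :=
  ereal_sup [set (mdist (ifs_iter f wn.1 wn.2 x1) (ifs_iter f wn.1 wn.2 x2))%:E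
            | wn in [set: (nat -> 'I_k) * nat]].

(* Continuity at every point of the identity (X, d) -> (X, d_F), spelled out
   for the two distances since X carries the topology of d only. *)
Definition ifs_equicontinuous (R : realType) (X : metricType R) (k : nat)
    (f : 'I_k -> X -> X) : Prop :=
  forall (x : X) (e : R), 0 < e ->
    exists2 delta : R, 0 < delta &
      forall y : X, mdist x y < delta -> (ifs_dist f x y < e%:E)%E.

(* Main.v *)
(* Equicontinuity forces minimality: if x has a neighbourhood B such that every
   T in F^+ maps B into the r/2-ball around T(x), then the sets T_i(B) supplied
   by weak topological exactness at B come r/2-close to any given v, so some
   T_i(x) is r-close to v. *)

Require Import Defs.
From mathcomp Require Import all_boot all_order all_algebra.
From mathcomp Require Import all_classical all_reals all_analysis.

Import Order.TTheory GRing.Theory Num.Theory.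

Local Open Scope classical_set_scope.
Local Open Scope ring_scope.

(** [ifs_iter] applies [w 0] first, whereas [foldr] puts the head of the word outermost; hence the
    reversal. *)
Lemma ifs_iter_foldr (X : Type) (k : nat) (f : 'I_k -> X -> X)
    (w : nat -> 'I_k) (n : nat) :
  ifs_iter f w n = foldr (fun i g => f i \o g) idfun (rev (mkseq w n)).
Proof. by elim: n => [//|n IHn]; rewrite mkseqS rev_rcons /= IHn. Qed.

Lemma ifs_semigroup_iter (X : Type) (k : nat) (f : 'I_k -> X -> X)
    (h : X -> X) :
  ifs_semigroup f h -> exists w n, h = ifs_iter f w n.
Proof.
(* The reversed word is continued by the letter [i], available since the word is nonempty; the first
   [size (i :: s)] steps never reach this default. *)
case=> -[//|i s] _ ->; exists (nth i (rev (i :: s))), (size (i :: s)).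
by rewrite ifs_iter_foldr -(size_rev (i :: s)) mkseq_nth revK.
Qed.

Lemma mdist_le_ifs_dist (R : realType) (X : metricType R) (k : nat)
    (f : 'I_k -> X -> X) (h : X -> X) (x y : X) :
  ifs_semigroup f h -> ((mdist (h x) (h y))%:E <= ifs_dist f x y)%E.
Proof.
by case/ifs_semigroup_iter=> w [n ->]; apply: ereal_sup_ubound; exists (w, n).
Qed.

Lemma equicontinuous_exact_minimal (R : realType) (X : metricType R) (k : nat)
    (f : 'I_k -> X -> X) :
  ifs_equicontinuous f -> weak_topologically_exact f -> ifs_minimal f.
Proof.
move=> feq fexact x O [v Ov] oO.
have /nbhs_ballP[r /= r0 rO] : nbhs v O by exact: open_nbhs_nbhs.
have r20 : 0 < r / 2 by rewrite divr_gt0.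
have [d d0 xd] := feq x _ r20.
(* Exactness and density speak of open sets, so balls are replaced by their interiors. *)
have [|N [T [semiT denseT]]] := fexact (ball x d)^° (open_interior _).
  by exists x; apply: nbhsx_ballx.
have [|y [/interior_subset vy [i _ [u /interior_subset xu Tuy]]]] :=
    denseT (ball v (r / 2))^° _ (open_interior _).
  by exists v; apply: nbhsx_ballx.
exists (T i x); split; last by exists (T i).
(* Pass through [y], equal to [T i u] with [u] in the [d]-ball around [x]: both [v] and [T i x] are
   within [r / 2] of it. *)
apply/rO/(ball_split vy)/ball_sym; rewrite -Tuy ballEmdist /=.
rewrite -lte_fin; apply: le_lt_trans; first exact: mdist_le_ifs_dist.
by apply: xd; move: xu; rewrite ballEmdist.
Qed.

Theorem corollary3p8 (R : realType) (X : metricType R)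
    (hX : compact [set: X]) (k : nat) (f : 'I_k -> X -> X)
    (hf : forall i : 'I_k, continuous (f i))
    (hcover : [set: X] = \bigcup_(i in [set: 'I_k]) (f i @` [set: X]))
    (hexact : weak_topologically_exact f)
    (hnotmin : ~ ifs_minimal f) :
  ~ ifs_equicontinuous f.
Proof. by move=> feq; apply: hnotmin; exact: equicontinuous_exact_minimal. Qed.
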